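(* Let $r\ge 2$. In the coordinate ring $\mathbb{C}[\mathfrak{X}_r]$ of the $\mathrm{SL}_2(\mathbb{C})$-character variety of the free group of rank $r$, the elements of the following three subsets of $\mathcal{G}(r)$ are together algebraically independent over $\mathbb{C}$: $$\{\mathrm{tr}(\mathbf{X}_i)\mid 1\le i\le r\},\qquad \{\mathrm{tr}(\mathbf{X}_1\mathbf{X}_i)\mid 2\le i\le r\},\qquad \{\mathrm{tr}(\mathbf{X}_2\mathbf{X}_i)\mid 3\le i\le r\}.$$ There are $r+(r-1)+(r-2)=3r-3$ of these elements, and the union of the three sets is a maximal algebraically independent subset of $\mathcal{G}(r)$.
   Context: Let $\mathcal{P}_r=\mathbb{C}[x^k_{ij}\mid 1\le i,j\le 2,\ 1\le k\le r]$ and let $\Delta_r$ be the ideal of $\mathcal{P}_r$ generated by $x^k_{11}x^k_{22}-x^k_{12}x^k_{21}-1$ for $1\le k\le r$, so that $\mathcal{P}_r/\Delta_r$ is the coordinate ring of $\mathrm{Hom}(F_r,\mathrm{SL}_2(\mathbb{C}))\cong \mathrm{SL}_2(\mathbb{C})^r$, where $F_r$ is the free group of rank $r$. The generic unimodular matrix $\mathbf{X}_k$ is the $2\times 2$ matrix over $\mathcal{P}_r/\Delta_r$ whose $(i,j)$ entry is the image of $x^k_{ij}$. The group $\mathrm{SL}_2(\mathbb{C})$ acts on $\mathrm{SL}_2(\mathbb{C})^r$ by simultaneous conjugation; the character variety $\mathfrak{X}_r$ is the GIT quotient, i.e. the affine variety with coordinate ring $\mathbb{C}[\mathfrak{X}_r]=(\mathcal{P}_r/\Delta_r)^{\mathrm{SL}_2(\mathbb{C})}$.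 Traces of words in $\mathbf{X}_1,\dots,\mathbf{X}_r$ are elements of this ring. Let $\mathcal{G}(r)=\mathcal{G}_1\cup\mathcal{G}_2\cup\mathcal{G}_3\subset\mathbb{C}[\mathfrak{X}_r]$, where $\mathcal{G}_1=\{\mathrm{tr}(\mathbf{X}_i)\mid 1\le i\le r\}$, $\mathcal{G}_2=\{\mathrm{tr}(\mathbf{X}_i\mathbf{X}_j)\mid 1\le i,j\le r,\ i\ne j\}$, and $\mathcal{G}_3=\{\mathrm{tr}(\mathbf{X}_i\mathbf{X}_j\mathbf{X}_k)\mid 1\le i<j<k\le r\}$. *)

(* Defs.v *)
From HB Require Import structures.
From mathcomp Require Import all_boot all_order all_algebra.
From mathcomp Require Import boolp classical_sets functions cardinality reals.
From mathcomp Require Import complex.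
From mathcomp Require Import mpoly.

Set Implicit Arguments.
Unset Strict Implicit.
Unset Printing Implicit Defensive.

Import GRing.Theory.

Local Open Scope ring_scope.
Local Open Scope quotient_scope.

(* An index (k, (i, j)) stands for the variable x^k_ij; all indices start at 0. *)
Notation xvar r := ('I_r * ('I_2 * 'I_2))%type.

Notation polyP K r := {mpoly K[#|{: xvar r}|]}.

Lemma det_mx22 (A : comPzRingType) (M : 'M[A]_2) :
  \det M = M 0 0 * M 1 1 - M 0 1 * M 1 0.
Proof.
rewrite (expand_det_row _ 0) big_ord_recl big_ord1 /cofactor !det_mx11 !mxE.
rewrite /= expr0 expr1 mul1r mulN1r mulrN.
by congr (M _ _ * M _ _ - M _ _ * M _ _); apply: val_inj.
Qed.

Section CoordinateRing.
Variables (K : fieldType) (r : nat).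

Local Notation P := (polyP K r).

Definition polyX (k : 'I_r) : 'M[P]_2 :=
  \matrix_(i, j) ('X_(enum_rank (k, (i, j))) : P).

Definition delta_gen (k : 'I_r) : P :=
  polyX k 0 0 * polyX k 1 1 - polyX k 0 1 * polyX k 1 0 - 1.

Definition Delta : {pred P} :=
  [pred p | `[< exists c : 'I_r -> P, p = \sum_k c k * delta_gen k >]].

Lemma DeltaP p :
  reflect (exists c : 'I_r -> P, p = \sum_k c k * delta_gen k) (p \in Delta).
Proof. exact: asboolP. Qed.

Lemma polyX_det k : \det (polyX k) - 1 = delta_gen k.
Proof. by rewrite det_mx22. Qed.

Lemma Delta_idealr_closed : idealr_closed Delta.
Proof.
split.
- by apply/DeltaP; exists (fun=> 0); rewrite big1 // => k _; rewrite mul0r.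
- apply/negP => /DeltaP[c e].
  pose v (m : 'I_#|{: xvar r}|) : K :=
    let: (k, (i, j)) := enum_val m in (i == j)%:R.
  have := congr1 (mmap (@idfun K) v) e.
  rewrite rmorph1 rmorph_sum big1 => [/eqP|k _].
    by rewrite oner_eq0.
  rewrite rmorphM rmorphB rmorphB !rmorphM rmorph1 !mxE /= !mmapX !mmap1U.
  by rewrite /v !enum_rankK /= mulr1 mulr0 subr0 subrr mulr0.
- move=> a p q /DeltaP[c ->] /DeltaP[d ->]; apply/DeltaP.
  exists (fun k => a * c k + d k); rewrite mulr_sumr -big_split.
  by apply: eq_bigr => k _; rewrite mulrDl mulrA.
Qed.

HB.instance Definition _ := isIdealr.Build P Delta Delta_idealr_closed.

Definition coordSL : Type := {ideal_quot Delta}.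

HB.instance Definition _ := GRing.ComNzRing.on coordSL.
HB.instance Definition _ := EqQuotient.on coordSL.

Definition to_coordSL (p : P) : coordSL := \pi_{ideal_quot Delta} p.

Lemma to_coordSL_zmod : zmod_morphism to_coordSL.
Proof. exact: (@rmorphB _ _ (\pi_{ideal_quot Delta})). Qed.

Lemma to_coordSL_monoid : monoid_morphism to_coordSL.
Proof. by split; [exact: rmorph1 | exact: rmorphM]. Qed.

HB.instance Definition _ :=
  GRing.isZmodMorphism.Build P coordSL to_coordSL to_coordSL_zmod.
HB.instance Definition _ :=
  GRing.isMonoidMorphism.Build P coordSL to_coordSL to_coordSL_monoid.

Lemma to_coordSL_eq p q : (to_coordSL p = to_coordSL q) <-> (p - q \in Delta).
Proof. by rewrite Quotient.idealrBE; split => /eqP. Qed.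

Lemma to_coordSL_repr (x : coordSL) : to_coordSL (repr x) = x.
Proof. exact: reprK. Qed.

Definition scaleSL (a : K) (x : coordSL) : coordSL := to_coordSL (a%:MP) * x.

Fact scaleSLA a b x : scaleSL a (scaleSL b x) = scaleSL (a * b) x.
Proof. by rewrite /scaleSL mulrA -rmorphM -mpolyCM. Qed.
Fact scaleSL1 : left_id 1 scaleSL.
Proof. by move=> x; rewrite /scaleSL mpolyC1 rmorph1 mul1r. Qed.
Fact scaleSLDr : right_distributive scaleSL +%R.
Proof. by move=> a x y; rewrite /scaleSL mulrDr. Qed.
Fact scaleSLDl x : {morph scaleSL^~ x : a b / a + b}.
Proof. by move=> a b; rewrite /scaleSL mpolyCD rmorphD mulrDl. Qed.

HB.instance Definition _ := GRing.Zmodule_isLmodule.Build K coordSL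
  scaleSLA scaleSL1 scaleSLDr scaleSLDl.

Fact scaleSLAl (a : K) (x y : coordSL) : a *: (x * y) = a *: x * y.
Proof. exact: mulrA. Qed.

HB.instance Definition _ := GRing.Lmodule_isLalgebra.Build K coordSL scaleSLAl.
HB.instance Definition _ := GRing.Lalgebra_isComAlgebra.Build K coordSL.

Lemma to_coordSL_scalable : scalable to_coordSL.
Proof. by move=> a p; rewrite -mul_mpolyC rmorphM. Qed.

HB.instance Definition _ :=
  GRing.isScalable.Build K P coordSL *:%R to_coordSL to_coordSL_scalable.

Definition genX (k : 'I_r) : 'M[coordSL]_2 := map_mx to_coordSL (polyX k).

(* (g . f)(A_1, ..., A_r) = f(g^-1 A_1 g, ..., g^-1 A_r g) on polynomials. *)
Definition conjX (g : 'M[K]_2) (k : 'I_r) : 'M[P]_2 :=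
  map_mx (@mpolyC _ K) (invmx g) *m polyX k *m map_mx (@mpolyC _ K) g.

Definition act_poly (g : 'M[K]_2) (p : P) : P :=
  mmap (@mpolyC _ K)
    (fun m => let: (k, (i, j)) := enum_val m in conjX g k i j) p.

Lemma act_poly_zmod g : zmod_morphism (act_poly g).
Proof. by move=> p q; rewrite /act_poly rmorphB. Qed.

Lemma act_poly_monoid g : monoid_morphism (act_poly g).
Proof. by split=> [|p q]; rewrite /act_poly ?rmorph1 ?rmorphM. Qed.

HB.instance Definition _ g :=
  GRing.isZmodMorphism.Build P P (act_poly g) (act_poly_zmod g).
HB.instance Definition _ g :=
  GRing.isMonoidMorphism.Build P P (act_poly g) (act_poly_monoid g).

Definition act (g : 'M[K]_2) (x : coordSL) : coordSL :=
  to_coordSL (act_poly g (repr x)).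

Lemma act_polyX g k : map_mx (act_poly g) (polyX k) = conjX g k.
Proof.
by apply/matrixP => i j; rewrite mxE [polyX k i j]mxE /act_poly mmapX mmap1U
  enum_rankK.
Qed.

Lemma act_polyC g a : act_poly g a%:MP = a%:MP.
Proof. exact: mmapC. Qed.

Lemma act_delta g k : \det g = 1 -> act_poly g (delta_gen k) = delta_gen k.
Proof.
move=> g1; rewrite -polyX_det rmorphB rmorph1 -det_map_mx act_polyX /conjX.
by rewrite !det_mulmx !det_map_mx det_inv g1 invr1 /= rmorph1 mul1r mulr1.
Qed.

Lemma act_to_coordSL g p :
  \det g = 1 -> act g (to_coordSL p) = to_coordSL (act_poly g p).
Proof.
move=> g1; apply/to_coordSL_eq; rewrite -rmorphB.
have /to_coordSL_eq/DeltaP[c ->] := to_coordSL_repr (to_coordSL p).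
apply/DeltaP; exists (fun k => act_poly g (c k)); rewrite rmorph_sum.
by apply: eq_bigr => k _; rewrite rmorphM /= act_delta.
Qed.

Lemma act_zmod g : \det g = 1 -> zmod_morphism (act g).
Proof.
move=> g1 x y; rewrite -[x]to_coordSL_repr -[y]to_coordSL_repr -rmorphB.
by rewrite !act_to_coordSL // !rmorphB.
Qed.

Lemma act_monoid g : \det g = 1 -> monoid_morphism (act g).
Proof.
move=> g1; split=> [|x y].
  by rewrite -(rmorph1 to_coordSL) act_to_coordSL // !rmorph1.
rewrite -[x]to_coordSL_repr -[y]to_coordSL_repr -rmorphM.
by rewrite !act_to_coordSL // !rmorphM.
Qed.

Lemma act_scalable g : \det g = 1 -> scalable (act g).
Proof.
move=> g1 a x; rewrite -[x]to_coordSL_repr -to_coordSL_scalable.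
by rewrite !act_to_coordSL // /act_poly mmapZ mul_mpolyC to_coordSL_scalable.
Qed.

Definition SL2_invariant : {pred coordSL} :=
  [pred x | `[< forall g : 'M[K]_2, \det g = 1 -> act g x = x >]].

Lemma SL2_invariantP x :
  reflect (forall g : 'M[K]_2, \det g = 1 -> act g x = x) (x \in SL2_invariant).
Proof. exact: asboolP. Qed.

Lemma SL2_invariant_subalg : subalg_closed SL2_invariant.
Proof.
split=> [|a x y|x y].
- by apply/SL2_invariantP => g g1; case: (act_monoid g1).
- move=> /SL2_invariantP hx /SL2_invariantP hy; apply/SL2_invariantP => g g1.
  have actB := act_zmod g1.
  have act0 : act g 0 = 0 by rewrite -{1}(subrr 0) actB subrr.
  have actN u : act g (- u) = - act g u by rewrite -sub0r actB act0 sub0r.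
  have -> : a *: x + y = a *: x - - y by rewrite opprK.
  by rewrite actB actN (act_scalable g1) (hx g g1) (hy g g1).
- move=> /SL2_invariantP hx /SL2_invariantP hy; apply/SL2_invariantP => g g1.
  by rewrite (act_monoid g1).2 (hx g g1) (hy g g1).
Qed.

HB.instance Definition _ :=
  GRing.isSubalgClosed.Build K coordSL SL2_invariant SL2_invariant_subalg.

(* The coordinate ring C[X_r] of the GIT quotient (for K the complex numbers). *)
Record charRing := CharRing {
  charRing_val :> coordSL;
  charRing_valP : charRing_val \in SL2_invariant }.

HB.instance Definition _ := [isSub for charRing_val].
HB.instance Definition _ := [Choice of charRing by <:].
HB.instance Definition _ := [SubChoice_isSubComNzRing of charRing by <:].
HB.instance Definition _ := [SubZmodule_isSubLmodule of charRing by <:].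
HB.instance Definition _ := [SubNzRing_SubLmodule_isSubLalgebra of charRing by <:].
HB.instance Definition _ := GRing.Lalgebra_isComAlgebra.Build K charRing.

Lemma act_genX g k : \det g = 1 ->
  map_mx (act g) (genX k) = map_mx to_coordSL (conjX g k).
Proof.
move=> g1; rewrite -act_polyX; apply/matrixP => i j.
by rewrite !mxE act_to_coordSL.
Qed.

Lemma trace_invariant (w : seq 'I_r) :
  \tr (\prod_(k <- w) genX k) \in SL2_invariant.
Proof.
apply/SL2_invariantP => g g1.
have gU : g \in unitmx by rewrite unitmxE g1 unitr1.
pose f := act g.
pose fZ := GRing.isZmodMorphism.Build _ _ f (act_zmod g1).
pose fM := GRing.isMonoidMorphism.Build _ _ f (act_monoid g1).
pose F : {rmorphism coordSL -> coordSL} := HB.pack f fZ fM.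
rewrite -[act g _]/(F _) -trace_map_mx rmorph_prod.
pose iota (a : K) : coordSL := to_coordSL a%:MP.
pose G := map_mx iota g; pose H := map_mx iota (invmx g).
have GH : G * H = 1.
  rewrite -[G * H](map_mxM (to_coordSL \o @mpolyC _ K)) mulmxV //.
  exact: (map_mx1 (to_coordSL \o @mpolyC _ K)).
have conjE k : map_mx F (genX k) = H * genX k * G.
  by rewrite [LHS]act_genX // /conjX !map_mxM -!map_mx_comp.
rewrite (eq_bigr _ (fun k _ => conjE k)).
have -> : \prod_(k <- w) (H * genX k * G) = H * (\prod_(k <- w) genX k) * G.
  elim: w => [|k w IHw].
    by rewrite !big_nil mulr1; apply/esym/mulmx1C.
  by rewrite !big_cons IHw !mulrA -(mulrA _ G H) GH mulr1.
by rewrite mxtrace_mulC !mulmxA (GH : G *m H = 1%:M) mul1mx.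
Qed.

(* The trace of the word X_{w_1} X_{w_2} ... in the generic matrices. *)
Definition word_trace (w : seq 'I_r) : charRing := CharRing (trace_invariant w).

Local Open Scope classical_set_scope.

Definition genG1 : set charRing := [set word_trace [:: i] | i in [set: 'I_r]].

Definition genG2 : set charRing :=
  [set x | exists i j : 'I_r, i != j /\ x = word_trace [:: i; j]].

Definition genG3 : set charRing :=
  [set x | exists i j k : 'I_r, (i < j < k)%N /\ x = word_trace [:: i; j; k]].

Definition genG : set charRing := genG1 `|` genG2 `|` genG3.

(* With indices starting at 0, these are {tr(X_1 X_i) | 2 <= i <= r} and
   {tr(X_2 X_i) | 3 <= i <= r} in the usual numbering of the matrices. *)
Definition traces_with_X1 : set charRing :=
  [set x | exists a i : 'I_r,
     [/\ nat_of_ord a = 0%N, (0 < i)%N & x = word_trace [:: a; i]]].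

Definition traces_with_X2 : set charRing :=
  [set x | exists a i : 'I_r,
     [/\ nat_of_ord a = 1%N, (1 < i)%N & x = word_trace [:: a; i]]].

End CoordinateRing.

Arguments genG1 : clear implicits.
Arguments genG2 : clear implicits.
Arguments genG3 : clear implicits.
Arguments genG : clear implicits.
Arguments traces_with_X1 : clear implicits.
Arguments traces_with_X2 : clear implicits.

Section AlgebraicIndependence.
Variables (K : fieldType) (A : comAlgType K).

Local Open Scope classical_set_scope.

Definition alg_independent (S : set A) : Prop :=
  forall (n : nat) (t : 'I_n -> A),
    injective t -> (forall i, S (t i)) ->
    forall p : {mpoly K[n]}, mmap (in_alg A) t p = 0 -> p = 0.

Definition maximal_alg_independent (G S : set A) : Prop :=
  [/\ S `<=` G, alg_independent S &
      forall T : set A, S `<=` T -> T `<=` G -> alg_independent T -> T = S].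

End AlgebraicIndependence.

(* Main.v *)
Require Import Defs.
From HB Require Import structures.
From mathcomp Require Import all_boot all_order all_algebra.
From mathcomp Require Import boolp classical_sets functions cardinality reals.
From mathcomp Require Import complex.
From mathcomp Require Import mpoly.
From mathcomp Require Import ring zify.

(** Removing its trace from each generic matrix gives r vectors in a space of
    dimension three, on which the trace form is a scalar product ([gram]) and the
    trace of [X (Y Z - Z Y)] is a volume form ([vol]). The basic
    traces amount to the lengths of the r vectors and the scalar products of all
    of them with the first two.

    Independence. Over a closed field, the basic traces of a tuple of matrices of
    determinant one take every value outside a hypersurface
    ([exists_rep_of_basis_traces]): a pair with prescribed traces has an explicit
    normal form, and once the pair is in general position, a further matrix is
    determined, up to a quadratic equation, by its trace and by the traces of its
    products with the pair ([exists_third]). A polynomial relation between the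
    traces therefore vanishes at every value outside the hypersurface, so it is
    zero ([meval_eq0]). The cardinalities follow, since an independent family is
    injective.

    Maximality. The product of two volumes is a determinant of scalar products
    ([vol_mul]). With both triples containing the first two vectors, this makes
    those volumes algebraic over the basic traces, and then every scalar product
    of two vectors ([gramX_algebraic]), since it appears linearly with the Gram
    minor of the first two vectors as coefficient. Then every volume is algebraic,
    as the square root of a polynomial in scalar products, and the trace of a
    product of three matrices is half a volume plus a polynomial in shorter traces
    ([trace_mul3]). To work in the coordinate ring itself rather than in a field,
    algebraic means integral after multiplication by a nonzero polynomial in the
    basic traces ([fracIntegral]), and this notion is stable under the operations
    just used. An algebraic element outside an independent set cannot be
    adjoined to it ([independent_family_maximal]). *)

Set Implicit Arguments.
Unset Strict Implicit.
Unset Printing Implicit Defensive.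

Import GRing.Theory Num.Theory.

Local Open Scope ring_scope.

(** * Multivariate polynomials and evaluation *)

Lemma mpoly_rmorph_ext (R S : comNzRingType) (n : nat)
    (f g : {rmorphism {mpoly R[n]} -> S}) :
  (forall c, f c%:MP = g c%:MP) -> (forall i, f 'X_i = g 'X_i) -> f =1 g.
Proof.
move=> fgC fgX p; rewrite (mpolyE p) !rmorph_sum; apply: eq_bigr => m _.
rewrite -mul_mpolyC !rmorphM /= fgC mpolyXE_id !rmorph_prod; congr (_ * _).
by apply: eq_bigr => i _; rewrite !rmorphXn fgX.
Qed.

Lemma rmorph_mmap (R T S : comNzRingType) (n : nat) (u : {rmorphism R -> T})
    (v : {rmorphism R -> S}) (f : {rmorphism T -> S}) (h : 'I_n -> T)
    (p : {mpoly R[n]}) :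
  (forall c, f (u c) = v c) -> f (mmap u h p) = mmap v (fun i => f (h i)) p.
Proof.
move=> fu; apply: (mpoly_rmorph_ext (f := f \o mmap u h) (g := mmap v _)) => [c|i] /=.
  by rewrite !mmapC fu.
by rewrite !mmapX !mmap1U.
Qed.

(** The inverse of [muni]: the main variable of [q] becomes the last variable.
    It turns a polynomial equation over a polynomial ring, as provided by
    algebraicity, into an algebraic relation in the sense of [mpoly]. *)
Definition mpoly_of_uni (R : comNzRingType) (n : nat)
  (q : {poly {mpoly R[n]}}) : {mpoly R[n.+1]} := (map_poly (@mwiden _ _) q).['X_ord_max].

Lemma widen_ord_max (n : nat) (i : 'I_n) :
  widen_ord (leqnSn n) i = lift ord_max i.
Proof. by apply: val_inj; rewrite /= /bump leqNgt ltn_ord. Qed.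

Lemma mmap_mpoly_of_uni (R T : comNzRingType) (n : nat) (u : {rmorphism R -> T})
    (h : 'I_n -> T) (x : T) (q : {poly {mpoly R[n]}}) :
  mmap u (fun k => if unlift ord_max k is Some j then h j else x) (mpoly_of_uni q)
  = (map_poly (mmap u h) q).[x].
Proof.
rewrite /mpoly_of_uni -horner_map /= mmapX mmap1U unlift_none; congr _.[_].
rewrite -map_poly_comp; apply: eq_map_poly => p.
apply: (mpoly_rmorph_ext (f := mmap u _ \o @mwiden _ _) (g := mmap u _)) => [c|i] /=.
  by rewrite mwidenC !mmapC.
by rewrite mwidenX mnmwiden1 !mmapX !mmap1U widen_ord_max liftK.
Qed.

Lemma muniX_widen (R : comNzRingType) (n : nat) (i : 'I_n) :
  muni 'X_(widen_ord (leqnSn n) i) = ('X_i : {mpoly R[n]})%:P.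
Proof.
rewrite muniE msuppX big_seq1 mcoeffX eqxx scale1r mnm1E.
rewrite (_ : (_ == ord_max) = false); last first.
  by apply/eqP => /(congr1 val) /= e; have := ltn_ord i; rewrite e ltnn.
rewrite expr0 alg_polyC; congr ('X_[_])%:P; apply/mnmP => j.
by rewrite mnmE !mnm1E.
Qed.

Lemma muniX_max (R : comNzRingType) (n : nat) :
  muni 'X_ord_max = ('X : {poly {mpoly R[n]}}).
Proof.
rewrite muniE msuppX big_seq1 mcoeffX eqxx scale1r mnm1E eqxx expr1.
rewrite (_ : [multinom _ | _ < _] = 0%MM) ?mpolyX0 ?scale1r //.
apply/mnmP => j; rewrite mnmE mnm1E mnm0E (_ : (_ == _) = false) //.
by apply/eqP => /(congr1 val) /= e; have := ltn_ord j; rewrite -e ltnn.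
Qed.

Lemma mpoly_of_uniK (R : comNzRingType) (n : nat) :
  cancel (@mpoly_of_uni R n) (@muni n R).
Proof.
move=> q; rewrite /mpoly_of_uni -horner_map /= muniX_max -map_poly_comp.
rewrite -[RHS]comp_polyXr /comp_poly; congr _.[_]; apply: eq_map_poly => p.
apply: (mpoly_rmorph_ext (f := @muni n R \o @mwiden _ _) (g := polyC)) => [c|i] /=.
  by rewrite mwidenC muniC.
by rewrite mwidenX mnmwiden1 muniX_widen.
Qed.

Lemma muniK (R : comNzRingType) (n : nat) : cancel (@muni n R) (@mpoly_of_uni R n).
Proof.
move=> p; rewrite /mpoly_of_uni.
apply: (mpoly_rmorph_ext (g := idfun)
  (f := horner_eval 'X_ord_max \o map_poly (@mwiden _ _) \o @muni n R)) => [c|i] /=.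
  by rewrite muniC map_polyC /= /horner_eval hornerC mwidenC.
have [j ->|->] := unliftP ord_max i.
  rewrite -widen_ord_max.
  by rewrite muniX_widen map_polyC /= /horner_eval hornerC mwidenX mnmwiden1.
by rewrite muniX_max map_polyX /horner_eval hornerX.
Qed.

Lemma poly_horner_eq0 (K : numDomainType) (q : {poly K}) :
  (forall c, q.[c] = 0) -> q = 0.
Proof.
move=> q0; apply/eqP/negPn/negP => qN0.
pose rs : seq K := [seq i%:R | i <- iota 0 (size q)].
have := @max_poly_roots K q rs qN0; rewrite size_map size_iota ltnn => H.
suff: false by []. apply: H.
  by apply/allP => c _; rewrite rootE q0.
by rewrite map_inj_uniq ?iota_uniq //; apply: mulrIn; rewrite oner_eq0.
Qed.

(** In characteristic zero the polynomial can be recovered from its values: by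
    induction on the number of variables, all the coefficients of [muni p]
    vanish, because fixing all variables but the last leaves a univariate
    polynomial with infinitely many roots. *)
Lemma meval_eq0 (K : numDomainType) (n : nat) (p : {mpoly K[n]}) :
  (forall v : 'I_n -> K, p.@[v] = 0) -> p = 0.
Proof.
elim: n p => [|n IHn] p p0.
  rewrite -[p](mpoly_rmorph_ext (f := @mpolyC 0 K \o meval (fun=> 0)) (g := idfun)) /=.
  - by rewrite p0 mpolyC0.
  - by move=> c; rewrite mevalC.
  - by case.
rewrite -[p]muniK; suff -> : muni p = 0 by rewrite /mpoly_of_uni rmorph0 horner0.
apply/polyP => i; rewrite coef0; apply: IHn => v.
rewrite -(coef_map (meval v)) (poly_horner_eq0 (q := map_poly _ _)) ?coef0 // => c.
by rewrite -mmap_mpoly_of_uni muniK; apply: p0.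
Qed.

(** * Elements that become integral after clearing a denominator *)

Section FracIntegral.
Variables (D : idomainType) (A : comNzRingType) (phi : {rmorphism D -> A}).

(** A substitute for algebraicity over the fraction field of [D] that makes
    sense when [A] is not known to be a domain: denominators are
    cleared by elements of [D], and integrality is stable under ring operations
    in every commutative ring. *)
Definition fracIntegral (x : A) : Prop :=
  exists2 d, d != 0 & integralOver phi (phi d * x).

Lemma fracIntegral_id a : fracIntegral (phi a).
Proof. by exists 1; rewrite ?oner_eq0 // -rmorphM; apply: integral_id. Qed.

Lemma fracIntegral_sub x y :
  fracIntegral x -> fracIntegral y -> fracIntegral (x - y).
Proof.
move=> [d dN0 dx] [e eN0 ey]; exists (d * e); first by rewrite mulf_neq0.
have -> : phi (d * e) * (x - y) = phi e * (phi d * x) - phi d * (phi e * y).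
  by rewrite rmorphM /=; ring.
by apply: integral_sub; apply: integral_mul => //; apply: integral_id.
Qed.

Lemma fracIntegral_mul x y :
  fracIntegral x -> fracIntegral y -> fracIntegral (x * y).
Proof.
move=> [d dN0 dx] [e eN0 ey]; exists (d * e); first by rewrite mulf_neq0.
by rewrite rmorphM mulrACA; apply: integral_mul.
Qed.

Lemma fracIntegral_nat n : fracIntegral n%:R.
Proof. by rewrite -(rmorph_nat phi); apply: fracIntegral_id. Qed.

Lemma fracIntegral_opp x : fracIntegral x -> fracIntegral (- x).
Proof. by rewrite -sub0r => xI; apply: fracIntegral_sub (fracIntegral_nat 0) xI. Qed.

Lemma fracIntegral_add x y :
  fracIntegral x -> fracIntegral y -> fracIntegral (x + y).
Proof. by rewrite -{2}[y]opprK => xI /fracIntegral_opp; apply: fracIntegral_sub. Qed.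

Lemma fracIntegral_mull c x : c != 0 -> fracIntegral (phi c * x) -> fracIntegral x.
Proof.
move=> cN0 [d dN0]; rewrite mulrA -rmorphM => dcx.
by exists (d * c); rewrite ?mulf_neq0.
Qed.

(** If [phi d * x ^+ 2] is integral, so is the square of [phi d * x]. *)
Lemma fracIntegral_sqrt x : fracIntegral (x ^+ 2) -> fracIntegral x.
Proof.
move=> [d dN0 dx2]; exists d => //; pose c := phi d * (phi d * x ^+ 2).
have cI : integralOver phi c by apply: integral_mul => //; apply: integral_id.
apply: (@integral_root_monic _ _ phi _ ('X^2 - c%:P)).
- rewrite monicE lead_coefDl ?lead_coefXn // size_polyXn size_polyN ltnS.
  exact: leq_trans (size_polyC_leq1 _) _.
- by rewrite rootE !hornerE /c; apply/eqP; ring.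
- apply/integral_poly => i; rewrite coefB coefXn coefC; apply: integral_sub.
    exact: integral_nat.
  by case: ifP => // _; apply: integral0.
Qed.

(** A monic equation [p] for [phi d * x] gives the equation [p (d X)] for [x],
    which is nonzero because [D] is a domain. *)
Lemma fracIntegral_root x : fracIntegral x ->
  exists2 q : {poly D}, q != 0 & root (map_poly phi q) x.
Proof.
move=> [d dN0 [p p_monic px]]; exists (p \Po (d *: 'X)).
  rewrite comp_poly2_eq0 ?monic_neq0 //.
  by rewrite size_scale // size_polyX.
by rewrite map_comp_poly /= map_polyZ map_polyX rootE horner_comp hornerZ hornerX.
Qed.

End FracIntegral.

(** * Independent finite families *)

Section Family.
Variables (K : fieldType) (A : comAlgType K).

Local Open Scope classical_set_scope.

(** Independence of a family indexed by an ordinal; unlike the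
    independence of a set, it speaks of one polynomial ring only, and it forces
    the family to be injective. *)
Definition independent_family (m : nat) (t : 'I_m -> A) :=
  forall p : {mpoly K[m]}, mmap (in_alg A) t p = 0 -> p = 0.

Lemma independent_family_inj m (t : 'I_m -> A) : independent_family t -> injective t.
Proof.
move=> t_indep i j tij; apply/eqP/negPn/negP => neq_ij.
have /eqP : ('X_i - 'X_j : {mpoly K[m]}) = 0.
  by apply: t_indep; rewrite rmorphB /= !mmapX !mmap1U tij subrr.
rewrite subr_eq0 => /eqP /(congr1 (meval (fun k => (k == i)%:R))).
by rewrite !mevalXU eqxx eq_sym (negbTE neq_ij) => /eqP; rewrite oner_eq0.
Qed.

Lemma alg_independent_range m (t : 'I_m -> A) :
  independent_family t -> alg_independent (range t).
Proof.
move=> t_indep k u u_inj u_range p pu0.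
have /fin_all_exists[w wE] (i : 'I_k) : exists j, t j = u i.
  by have [j _ <-] := u_range i; exists j.
have w_inj : injective w by move=> i j wij; apply: u_inj; rewrite -!wE wij.
(* Renaming the variables along the injection w has a left inverse. *)
pose up := mmap (@mpolyC m K) (fun i => 'X_(w i)).
pose down := mmap (@mpolyC k K)
  (fun j => if [pick i | w i == j] is Some i then 'X_i else 0).
have upK q : down (up q) = q.
  apply: (mpoly_rmorph_ext (f := down \o up) (g := idfun)) => [c|i] /=.
    by rewrite /up mmapC /down mmapC.
  rewrite /up mmapX mmap1U /down mmapX mmap1U.
  by case: pickP => [l /eqP /w_inj -> // | /(_ i)]; rewrite eqxx.
suff up0 : up p = 0 by rewrite -[p]upK up0 /down rmorph0.
apply: t_indep; rewrite -[RHS]pu0 /up (rmorph_mmap (v := in_alg A)) => [|c].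
  by congr (mmap _ _ p); apply/funext => i /=; rewrite mmapX mmap1U wE.
by rewrite /= mmapC.
Qed.

(** Adjoining to [t] an algebraic element [x] outside its range would produce an
    injective family of [T] with the relation read off from an equation of [x].
    Algebraicity is only required after an embedding [v] into a larger ring [S],
    where computations may be easier. *)
Lemma independent_family_maximal (S : comNzRingType) (v : {rmorphism A -> S})
    (m : nat) (t : 'I_m -> A) (phi : {rmorphism {mpoly K[m]} -> S})
    (T : set A) (x : A) :
  injective v -> (forall a : K, phi a%:MP = v a%:A) ->
  (forall i, phi 'X_i = v (t i)) ->
  independent_family t -> alg_independent T -> (forall i, T (t i)) -> T x ->
  fracIntegral phi (v x) -> range t x.
Proof.
move=> v_inj phiC phiX t_indep T_indep tT Tx /fracIntegral_root[q qN0 /rootP qx].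
apply: contrapT => xt; have t_inj := independent_family_inj t_indep.
pose u k := if unlift ord_max k is Some j then t j else x.
have u_inj : injective u.
  move=> a b; rewrite /u; case: (unliftP ord_max a) => [a' ->|->];
    case: (unliftP ord_max b) => [b' ->|->] //.
  - by move=> /t_inj ->.
  - by move=> e; case: xt; exists a'.
  - by move=> e; case: xt; exists b'.
have uT k : T (u k) by rewrite /u; case: unliftP.
suff q0 : mpoly_of_uni q = 0.
  by move: qN0; rewrite -(mpoly_of_uniK q) q0 muni0 eqxx.
apply: (T_indep _ _ u_inj uT); apply: v_inj; rewrite rmorph0 -[RHS]qx.
rewrite (rmorph_mmap (v := v \o in_alg A)) //.
transitivity (map_poly (mmap (v \o in_alg A) (fun i => v (t i))) q).[v x].
  rewrite -mmap_mpoly_of_uni.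
  by congr (mmap _ _ _); apply/funext => k; rewrite /u; case: unliftP.
congr _.[_]; apply: eq_map_poly => p.
apply: (mpoly_rmorph_ext (f := mmap _ _)) => [c|i] /=; first by rewrite mmapC /= phiC.
by rewrite mmapX mmap1U phiX.
Qed.

End Family.

(** * Trace identities for two by two matrices *)

Section TraceIdentities.
Variable A : comPzRingType.
Implicit Types X Y Z W : 'M[A]_2.

(** Up to a factor two, the trace form on the traceless parts of [X] and [Y]. *)
Definition gram X Y := 2 * \tr (X * Y) - \tr X * \tr Y.
(** The trace of [X (Y Z - Z Y)], which depends on the traceless parts only: it
    is an alternating trilinear form on a space of dimension three, hence a
    volume form. *)
Definition vol X Y Z := \tr (X * Y * Z) - \tr (X * Z * Y).

Lemma mxtrace2 X : \tr X = X 0 0 + X 1 1.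
Proof.
by rewrite /mxtrace big_ord_recl big_ord1; congr (X _ _ + X _ _); apply: val_inj.
Qed.

Lemma mulmx2 X Y i j : (X * Y) i j = X i 0 * Y 0 j + X i 1 * Y 1 j.
Proof.
rewrite [LHS]mxE big_ord_recl big_ord1.
by congr (X i _ * Y _ j + X i _ * Y _ j); apply: val_inj.
Qed.

Lemma gramC X Y : gram X Y = gram Y X.
Proof. by rewrite /gram mxtrace_mulC [\tr X * _]mulrC. Qed.

Lemma gramXX X : \det X = 1 -> gram X X = \tr X ^+ 2 - 4.
Proof.
move=> dX; transitivity (\tr X ^+ 2 - 4 * \det X); last by rewrite dX mulr1.
by rewrite /gram det_mx22 !mxtrace2 !mulmx2; ring.
Qed.

(** In a space of dimension three the product of the volumes of two triples is,
    up to a constant, the determinant of their scalar products, since both are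
    alternating in each triple; here the triples share two vectors. *)
Lemma vol_mul X Y Z W :
  4 * (vol X Y Z * vol X Y W) =
  - (gram X X * (gram Y Y * gram Z W - gram Y W * gram Y Z)
     - gram X Y * (gram X Y * gram Z W - gram Y W * gram X Z)
     + gram X W * (gram X Y * gram Y Z - gram Y Y * gram X Z)).
Proof.
rewrite /gram /vol !mxtrace2 !mulmx2; ring.
Qed.

(** The polarized Cayley-Hamilton identity expresses
    [\tr (X * Y * Z) + \tr (X * Z * Y)] by shorter traces, and the difference
    of these two traces is a volume. *)
Lemma trace_mul3 X Y Z :
  2 * \tr (X * Y * Z) = vol X Y Z + \tr X * \tr (Y * Z) + \tr Y * \tr (X * Z)
    + \tr Z * \tr (X * Y) - \tr X * \tr Y * \tr Z.
Proof. rewrite /vol !mxtrace2 !mulmx2; ring. Qed.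
End TraceIdentities.

(** * Points of the representation variety *)

Lemma det_genX (K : fieldType) (r : nat) (k : 'I_r) : \det (genX K k) = 1.
Proof.
rewrite /genX det_map_mx -(rmorph1 (@to_coordSL K r)); apply/to_coordSL_eq.
rewrite polyX_det; apply/DeltaP; exists (fun l => (l == k)%:R).
rewrite (bigD1 k) //= eqxx mul1r big1 ?addr0 // => l /negbTE ->.
by rewrite mul0r.
Qed.

(** A tuple of matrices of determinant one kills the generators of [Delta], so
    evaluation at this tuple is defined on the quotient ring. *)
Lemma eval_point (K : fieldType) (r : nat) (rho : 'I_r -> 'M[K]_2) :
  (forall k, \det (rho k) = 1) ->
  exists f : {rmorphism coordSL K r -> K},
    (forall a, f a%:A = a) /\ forall k, map_mx f (genX K k) = rho k.
Proof.
move=> rho1.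
pose v (m : 'I_#|{: xvar r}|) : K := let: (k, (i, j)) := enum_val m in rho k i j.
pose f (x : coordSL K r) : K := (repr x).@[v].
have polyXv k : map_mx (meval v) (Defs.polyX K k) = rho k.
  by apply/matrixP => i j; rewrite !mxE mevalXU /v enum_rankK.
have fE p : f (to_coordSL p) = p.@[v].
  have /to_coordSL_eq/DeltaP[c e] := to_coordSL_repr (to_coordSL p).
  apply/eqP; rewrite -subr_eq0 -mevalB e raddf_sum big1 // => k _ /=.
  rewrite mevalM -polyX_det mevalB -det_map_mx polyXv rho1 meval1 subrr.
  by rewrite mulr0.
have f_zmod : zmod_morphism f.
  move=> x y; rewrite -[x]to_coordSL_repr -[y]to_coordSL_repr -rmorphB.
  by rewrite !fE mevalB.
have f_monoid : monoid_morphism f.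
  split=> [|x y]; first by rewrite -(rmorph1 (@to_coordSL K r)) fE meval1.
  rewrite -[x]to_coordSL_repr -[y]to_coordSL_repr -rmorphM.
  by rewrite !fE mevalM.
pose fZ := GRing.isZmodMorphism.Build _ _ f f_zmod.
pose fM := GRing.isMonoidMorphism.Build _ _ f f_monoid.
pose F : {rmorphism coordSL K r -> K} := HB.pack f fZ fM.
exists F; split=> [a|k].
  rewrite -(rmorph1 (@to_coordSL K r)) -linearZ /= fE mevalZ meval1; exact: mulr1.
rewrite -polyXv; apply/matrixP => i j; rewrite !mxE; exact: fE.
Qed.

Definition mx2 (A : Type) (a b c d : A) : 'M[A]_2 :=
  \matrix_(i, j) if i == 0 then if j == 0 then a else b
                 else if j == 0 then c else d.

Lemma quadratic_root (K : numClosedFieldType) (a b c : K) :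
  a != 0 -> exists x, a * x ^+ 2 + b * x + c = 0.
Proof.
move=> aN0; pose s := sqrtC (b ^+ 2 - 4 * a * c).
have sE : s ^+ 2 = b ^+ 2 - 4 * a * c by rewrite sqrtCK.
exists ((s - b) / (2 * a)).
transitivity ((s ^+ 2 - (b ^+ 2 - 4 * a * c)) / (4 * a)); last first.
  by rewrite sE subrr mul0r.
by field.
Qed.

(** The determinant of the matrix of scalar products [gram] of two matrices of
    determinant one with traces [x] and [y] and product of trace [z]. It is
    nonzero exactly when this pair is irreducible. *)
Definition gram_minor (A : comPzRingType) (x y z : A) : A :=
  (x ^+ 2 - 4) * (y ^+ 2 - 4) - (2 * z - x * y) ^+ 2.

(** A normal form for a pair of matrices with prescribed traces; the trace of
    the product takes every value over a closed field as [b] varies. *)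
Lemma first_pair_traces (K : numClosedFieldType) (b x y : K) :
  b != 0 ->
  [/\ \det (mx2 x (-1) 1 0) = 1, \det (mx2 0 b (- b^-1) y) = 1,
    \tr (mx2 x (-1) 1 0) = x, \tr (mx2 0 b (- b^-1) y) = y &
    \tr (mx2 x (-1) 1 0 * mx2 0 b (- b^-1) y) = b + b^-1].
Proof.
by move=> bN0; split; rewrite ?det_mx22 ?mxtrace2 ?mulmx2 !mxE /=; field.
Qed.

(** The three trace conditions are affine in the entries of [M], so they leave
    one free entry [p]; the condition on the determinant is then quadratic in
    [p], with leading coefficient proportional to [gram_minor]. *)
Lemma exists_third (K : numClosedFieldType) (b x y t1 t2 t3 : K) :
  b != 0 -> b - b^-1 != 0 -> gram_minor x y (b + b^-1) != 0 ->
  exists M : 'M[K]_2, [/\ \det M = 1, \tr M = t1,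
    \tr (mx2 x (-1) 1 0 * M) = t2 & \tr (mx2 0 b (- b^-1) y * M) = t3].
Proof.
move=> bN0 wN0 kN0; set w := b - b^-1 in wN0.
(* The lower left entry of M forced by the trace conditions is s0 + s1 * p,
   where p is the upper left entry. *)
pose s1 := (y - x / b) / w; pose s0 := (t3 + t2 / b - y * t1) / w.
have ws1 : w * s1 = y - x / b by rewrite mulrC divfK.
have ws0 : w * s0 = t3 + t2 / b - y * t1 by rewrite mulrC divfK.
have aN0 : 1 + s1 ^+ 2 - x * s1 != 0.
  have : - 4 * w ^+ 2 * (1 + s1 ^+ 2 - x * s1) != 0.
    apply: contra_neq kN0 => <-.
    transitivity (- 4 * (w ^+ 2 + (w * s1) ^+ 2 - x * w * (w * s1))); last by ring.
    by rewrite ws1 /gram_minor /w; field.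
  by rewrite mulf_eq0 negb_or => /andP[].
have [p pE] := quadratic_root (s1 * (t2 + s0) + s0 * (s1 - x) - t1)
  (1 + s0 * (t2 + s0)) aN0.
pose s := s0 + s1 * p.
have sE : b * s - (t2 - x * p + s) / b + y * (t1 - p) = t3.
  transitivity (w * s0 + w * s1 * p - t2 / b + x * p / b + y * t1 - y * p).
    by rewrite /s /w; ring.
  by rewrite ws0 ws1; ring.
exists (mx2 p (t2 - x * p + s) s (t1 - p)).
split; rewrite ?det_mx22 ?mxtrace2 ?mulmx2 !mxE /=.
- transitivity (1 - ((1 + s1 ^+ 2 - x * s1) * p ^+ 2 +
    (s1 * (t2 + s0) + s0 * (s1 - x) - t1) * p + (1 + s0 * (t2 + s0)))).
    rewrite /s; ring.
  by rewrite pE subr0.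
- ring.
- ring.
- rewrite -[RHS]sE; ring.
Qed.

(** * Independence of the basic traces *)

(** Indices for the traces of [X_i], then of [X_0 X_i] with [0 < i], then of
    [X_1 X_i] with [1 < i], for [r = n.+2] matrices numbered from zero. *)
Definition basisIdx (n : nat) : finType := ('I_n.+2 + 'I_n.+1 + 'I_n)%type.

Definition basis_word (n : nat) (j : basisIdx n) : seq 'I_n.+2 :=
  match j with
  | inl (inl i) => [:: i]
  | inl (inr i) => [:: ord0; lift ord0 i]
  | inr i => [:: lift ord0 ord0; lift ord0 (lift ord0 i)]
  end.

Definition basis_trace (K : fieldType) (n : nat) (j : basisIdx n) :
  charRing K n.+2 := word_trace K (basis_word j).

Definition idx_tr0 (n : nat) : basisIdx n := inl (inl ord0).
Definition idx_tr1 (n : nat) : basisIdx n := inl (inl (lift ord0 ord0)).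
Definition idx_tr01 (n : nat) : basisIdx n := inl (inr ord0).

(** The traces take all values outside a hypersurface: the first three fix a pair
    of matrices, and every other matrix is then found separately, from its own
    trace and its products with this pair. *)
Lemma exists_rep_of_basis_traces (K : numClosedFieldType) (n : nat)
    (v : basisIdx n -> K) :
  gram_minor (v (idx_tr0 n)) (v (idx_tr1 n)) (v (idx_tr01 n)) != 0 ->
  v (idx_tr01 n) ^+ 2 - 4 != 0 ->
  exists rho : 'I_n.+2 -> 'M[K]_2, (forall k, \det (rho k) = 1) /\
    forall j, \tr (\prod_(k <- basis_word j) rho k) = v j.
Proof.
set x := v (idx_tr0 n); set y := v (idx_tr1 n); set z := v (idx_tr01 n) => kN0 zN0.
(* b is an eigenvalue of the product of the first two matrices. *)
have [b bE] := quadratic_root (- z) 1 (oner_neq0 K).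
have bE1 : b * (z - b) = 1.
  by apply/eqP; rewrite -subr_eq0 -oppr_eq0 -bE; apply/eqP; ring.
have bN0 : b != 0.
  by apply: contra_eq_neq bE1 => ->; rewrite mul0r eq_sym oner_eq0.
have bV : b^-1 = z - b by apply: (mulfI bN0); rewrite mulfV.
have zE : b + b^-1 = z by rewrite bV addrC subrK.
have wN0 : b - b^-1 != 0.
  apply: contra_neq zN0 => w0; transitivity ((b - b^-1) ^+ 2).
    by rewrite -zE; field.
  by rewrite w0 expr0n.
rewrite -zE in kN0.
have [dX0 dX1 tX0 tX1 tX01] := first_pair_traces x y bN0.
have /fin_all_exists[N NP] (i : 'I_n) := exists_third
  (v (inl (inl (lift ord0 (lift ord0 i))))) (v (inl (inr (lift ord0 i))))
  (v (inr i)) bN0 wN0 kN0.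
pose X0 := mx2 x (-1) 1 0; pose X1 := mx2 0 b (- b^-1) y.
pose rho (k : 'I_n.+2) := if unlift ord0 k is Some k1 then
  if unlift ord0 k1 is Some k2 then N k2 else X1 else X0.
have rho0 : rho ord0 = X0 by rewrite /rho unlift_none.
have rho1 : rho (lift ord0 ord0) = X1 by rewrite /rho liftK unlift_none.
have rho2 i : rho (lift ord0 (lift ord0 i)) = N i by rewrite /rho !liftK.
exists rho; split=> [k|].
  case: (unliftP ord0 k) => [k1 ->|->]; last by rewrite rho0.
  case: (unliftP ord0 k1) => [k2 ->|->]; last by rewrite rho1.
  by rewrite rho2; have [] := NP k2.
case=> [[i|i]|i] /=; rewrite !big_cons big_nil mulr1.
- case: (unliftP ord0 i) => [k1 ->|->]; last by rewrite rho0.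
  case: (unliftP ord0 k1) => [k2 ->|->]; last by rewrite rho1.
  by rewrite rho2; have [] := NP k2.
- rewrite rho0; case: (unliftP ord0 i) => [k2 ->|->].
    by rewrite rho2; have [] := NP k2.
  by rewrite rho1 tX01 zE.
- by rewrite rho1 rho2; have [] := NP i.
Qed.

(** A relation vanishes at all values of the traces, hence everywhere after
    multiplication by an equation [d] of the exceptional hypersurface. *)
Lemma basis_trace_independent (K : numClosedFieldType) (n : nat) :
  independent_family
    (fun m : 'I_#|basisIdx n| => basis_trace K (enum_val m)).
Proof.
move=> p p0; pose var (j : basisIdx n) : {mpoly K[#|basisIdx n|]} := 'X_(enum_rank j).
pose d := gram_minor (var (idx_tr0 n)) (var (idx_tr1 n)) (var (idx_tr01 n)) *
  (var (idx_tr01 n) ^+ 2 - 4).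
have dE v : d.@[v] =
    gram_minor (v (enum_rank (idx_tr0 n))) (v (enum_rank (idx_tr1 n)))
      (v (enum_rank (idx_tr01 n)))
    * (v (enum_rank (idx_tr01 n)) ^+ 2 - 4).
  by rewrite /d /gram_minor !(rmorphM, rmorphB, rmorphXn, rmorph_nat) /= !mevalXU.
have dN0 : d != 0.
  apply: contra_eq_neq (dE (fun=> 0)) => ->; rewrite meval0 eq_sym.
  rewrite (_ : _ * _ = - 64%:R) ?oppr_eq0 ?pnatr_eq0 //.
  by rewrite /gram_minor; ring.
suff : p * d = 0 by move/eqP; rewrite mulf_eq0 (negbTE dN0) orbF => /eqP.
apply: meval_eq0 => v; rewrite mevalM; have [->|] := eqVneq d.@[v] 0.
  by rewrite mulr0.
rewrite dE mulf_eq0 negb_or => /andP[kN0 zN0].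
have [rho [rho1 rhoE]] :=
  exists_rep_of_basis_traces (v := fun j => v (enum_rank j)) kN0 zN0.
have [f [fC fX]] := eval_point rho1.
suff -> : p.@[v] = 0 by rewrite mul0r.
rewrite -(rmorph0 (f \o (\val : charRing K n.+2 -> coordSL K n.+2))) -p0.
rewrite (rmorph_mmap (v := idfun)) => [|c] /=; last exact: fC.
apply: meval_eq => m; rewrite -trace_map_mx rmorph_prod /=.
rewrite (eq_bigr rho) => [|k _]; last exact: fX.
by rewrite rhoE enum_valK.
Qed.

(** * Algebraicity of all traces over the basic ones *)

Section TraceAlgebraicity.
Variables (D : idomainType) (A : comNzRingType) (phi : {rmorphism D -> A}).
Hypothesis two_neq0 : 2%:R != 0 :> D.
Local Notation algebraic := (fracIntegral phi).

Lemma fracIntegral_double x : algebraic (2 * x) -> algebraic x.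
Proof. by rewrite -(rmorph_nat phi 2); apply: fracIntegral_mull. Qed.

Lemma gram_algebraic (P Q : 'M[A]_2) :
  algebraic (\tr P) -> algebraic (\tr Q) -> algebraic (\tr (P * Q)) ->
  algebraic (gram P Q).
Proof.
move=> hP hQ hPQ; rewrite /gram; apply: fracIntegral_sub; apply: fracIntegral_mul => //.
exact: fracIntegral_nat.
Qed.

Lemma gram_diag_algebraic (P : 'M[A]_2) :
  \det P = 1 -> algebraic (\tr P) -> algebraic (gram P P).
Proof.
move=> dP hP; rewrite gramXX // expr2; apply: fracIntegral_sub.
  exact: fracIntegral_mul.
exact: fracIntegral_nat.
Qed.

(** The square of a volume is a polynomial in scalar products. *)
Lemma vol_algebraic (P Q R : 'M[A]_2) :
  algebraic (gram P P) -> algebraic (gram Q Q) -> algebraic (gram R R) ->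
  algebraic (gram P Q) -> algebraic (gram P R) -> algebraic (gram Q R) ->
  algebraic (vol P Q R).
Proof.
move=> hPP hQQ hRR hPQ hPR hQR.
apply/fracIntegral_sqrt/fracIntegral_double/fracIntegral_double.
rewrite mulrA -natrM expr2 vol_mul.
move: (gram P P) hPP (gram Q Q) hQQ (gram R R) hRR.
move: (gram P Q) hPQ (gram P R) hPR (gram Q R) hQR => *.
by do ![assumption | apply: fracIntegral_opp | apply: fracIntegral_sub
  | apply: fracIntegral_add | apply: fracIntegral_mul].
Qed.

Variables (I : Type) (X : I -> 'M[A]_2) (o0 o1 : I).
Hypothesis detX : forall i, \det (X i) = 1.
Hypothesis trX : forall i, algebraic (\tr (X i)).
Hypothesis gram0X : forall i, algebraic (gram (X o0) (X i)).
Hypothesis gram1X : forall i, algebraic (gram (X o1) (X i)).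
Hypothesis gram_minor_neq0 : exists2 d, d != 0 &
  phi d = gram (X o0) (X o0) * gram (X o1) (X o1) - gram (X o0) (X o1) ^+ 2.

(** The product of the volumes of [(X o0, X o1, X i)] and [(X o0, X o1, X j)] is
    affine in [gram (X i) (X j)], with leading coefficient the minor of
    [X o0] and [X o1]; every other term involves [X o0] or [X o1]. *)
Lemma gramX_algebraic i j : algebraic (gram (X i) (X j)).
Proof.
have vol01 k : algebraic (vol (X o0) (X o1) (X k)).
  by apply: vol_algebraic => //; apply: gram_diag_algebraic.
have [d dN0 dE] := gram_minor_neq0.
apply: (fracIntegral_mull dN0); rewrite dE.
have -> : (gram (X o0) (X o0) * gram (X o1) (X o1) - gram (X o0) (X o1) ^+ 2)
    * gram (X i) (X j) =
  - (4 * (vol (X o0) (X o1) (X i) * vol (X o0) (X o1) (X j)))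
  + gram (X o0) (X o0) * (gram (X o1) (X j) * gram (X o1) (X i))
  - gram (X o0) (X o1) * (gram (X o1) (X j) * gram (X o0) (X i))
  - gram (X o0) (X j) *
    (gram (X o0) (X o1) * gram (X o1) (X i) - gram (X o1) (X o1) * gram (X o0) (X i)).
  by rewrite vol_mul; ring.
have fourI : algebraic 4 by apply: fracIntegral_nat.
(* What remains is a polynomial in volumes and scalar products known to be
   algebraic. *)
move: (vol (X o0) (X o1) (X i)) (vol01 i) (vol (X o0) (X o1) (X j)) (vol01 j).
move: (gram (X o1) (X o1)) (gram1X o1) (gram (X o1) (X i)) (gram1X i)
  (gram (X o1) (X j)) (gram1X j).
move: (gram (X o0) (X o0)) (gram0X o0) (gram (X o0) (X o1)) (gram0X o1)
  (gram (X o0) (X i)) (gram0X i) (gram (X o0) (X j)) (gram0X j) => *.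
by do ![assumption | apply: fracIntegral_opp | apply: fracIntegral_sub
  | apply: fracIntegral_add | apply: fracIntegral_mul].
Qed.

Lemma trace2_algebraic i j : algebraic (\tr (X i * X j)).
Proof.
apply: fracIntegral_double.
rewrite -[_ * _](subrK (\tr (X i) * \tr (X j))); apply: fracIntegral_add.
  exact: gramX_algebraic.
exact: fracIntegral_mul.
Qed.

Lemma trace3_algebraic i j k : algebraic (\tr (X i * X j * X k)).
Proof.
apply: fracIntegral_double; rewrite trace_mul3.
have volX : algebraic (vol (X i) (X j) (X k)).
  by apply: vol_algebraic; apply: gramX_algebraic.
move: (vol _ _ _) volX (\tr (X j * X k)) (trace2_algebraic j k)
  (\tr (X i * X k)) (trace2_algebraic i k)
  (\tr (X i * X j)) (trace2_algebraic i j).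
move: (\tr (X i)) (trX i) (\tr (X j)) (trX j) (\tr (X k)) (trX k) => *.
by do ![assumption | apply: fracIntegral_sub | apply: fracIntegral_add
  | apply: fracIntegral_mul].
Qed.

End TraceAlgebraicity.

Section BasisAlgebraicity.
Variables (K : numFieldType) (n : nat).
Local Notation J := (basisIdx n).
Local Notation S := (coordSL K n.+2).

(** The target is the whole coordinate ring, where the generic matrices live,
    instead of the subring of invariants. *)
Definition basis_eval : {rmorphism {mpoly K[#|J|]} -> S} :=
  mmap (in_alg S) (fun m => \val (basis_trace K (enum_val m))).

Lemma basis_eval_var (j : J) :
  basis_eval 'X_(enum_rank j) = \tr (\prod_(k <- basis_word j) genX K k).
Proof. by rewrite /basis_eval /= mmapX mmap1U enum_rankK. Qed.

Lemma basis_evalC (a : K) : basis_eval a%:MP = \val (a%:A : charRing K n.+2).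
Proof. by rewrite linearZ /basis_eval /= mmapC. Qed.

Lemma genG_algebraic (x : charRing K n.+2) :
  genG K n.+2 x -> fracIntegral basis_eval (\val x).
Proof.
have trB (j : J) : fracIntegral basis_eval (\tr (\prod_(k <- basis_word j) genX K k)).
  by rewrite -basis_eval_var; apply: fracIntegral_id.
have tr1 i : fracIntegral basis_eval (\tr (genX K i)).
  by have := trB (inl (inl i)); rewrite big_seq1.
have two_neq0 : 2%:R != 0 :> {mpoly K[#|J|]}.
  by rewrite -mpolyC_nat mpolyC_eq0 pnatr_eq0.
have gramd i := gram_diag_algebraic (det_genX K i) (tr1 i).
pose o0 : 'I_n.+2 := ord0; pose o1 : 'I_n.+2 := lift ord0 ord0.
have gram0 i : fracIntegral basis_eval (gram (genX K o0) (genX K i)).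
  case: (unliftP ord0 i) => [k ->|->]; last exact: gramd.
  apply: gram_algebraic => //.
  by have := trB (inl (inr k)); rewrite big_cons big_seq1.
have gram1 i : fracIntegral basis_eval (gram (genX K o1) (genX K i)).
  case: (unliftP ord0 i) => [k ->|->]; last by rewrite gramC; apply: gram0.
  case: (unliftP ord0 k) => [l ->|->]; last exact: gramd.
  apply: gram_algebraic => //.
  by have := trB (inr l); rewrite big_cons big_seq1.
have minor : exists2 d, d != 0 & basis_eval d =
    gram (genX K o0) (genX K o0) * gram (genX K o1) (genX K o1)
    - gram (genX K o0) (genX K o1) ^+ 2.
  pose var (j : J) : {mpoly K[#|J|]} := 'X_(enum_rank j).
  pose d := gram_minor (var (idx_tr0 n)) (var (idx_tr1 n)) (var (idx_tr01 n)).
  exists d.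
    suff dE : d.@[fun=> 0] = 16%:R.
      by apply: contra_eq_neq dE => ->; rewrite meval0 eq_sym pnatr_eq0.
    rewrite /d /gram_minor !(rmorphM, rmorphB, rmorphXn, rmorph_nat) /= !mevalXU; ring.
  rewrite /d /gram_minor !(rmorphM, rmorphB, rmorphXn, rmorph_nat) /= !basis_eval_var.
  by rewrite !gramXX ?det_genX // /gram /= !big_seq1 big_cons big_seq1.
have tr2 := trace2_algebraic two_neq0 (@det_genX K n.+2) tr1 gram0 gram1 minor.
have tr3 := trace3_algebraic two_neq0 (@det_genX K n.+2) tr1 gram0 gram1 minor.
case=> [[[i _ <-]|[i [j [_ ->]]]]|[i [j [k [_ ->]]]]] /=.
- by rewrite big_seq1.
- by rewrite big_cons big_seq1.
- by rewrite !big_cons big_nil mulr1 mulrA.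
Qed.
End BasisAlgebraicity.

Local Open Scope classical_set_scope.
Local Open Scope card_scope.

(** * The maximal independent set *)

Lemma card_range_finType (T : finType) (U : Type) (f : T -> U) :
  injective f -> range f #= `I_#|T|.
Proof.
move=> f_inj; rewrite (_ : range f = range (f \o (@enum_val T T))).
  rewrite (card_eqr card_II); apply: inj_card_eq => a b _ _ /f_inj.
  exact: enum_val_inj.
by apply/seteqP; split=> x [y _ <-]; [exists (enum_rank y); rewrite //= enum_rankK
  | exists (enum_val y)].
Qed.

Lemma traces_rangeE (K : fieldType) (n : nat) :
  [/\ genG1 K n.+2 = range (fun i => basis_trace K (inl (inl i) : basisIdx n)),
      traces_with_X1 K n.+2 = range (fun i => basis_trace K (inl (inr i) : basisIdx n)) &
      traces_with_X2 K n.+2 = range (fun i => basis_trace K (inr i : basisIdx n))].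
Proof.
split=> //; apply/seteqP; split=> x /=.
- move=> [a [i [a0 i0 ->]]]; have {a0}-> : a = ord0 by apply: val_inj.
  case: (unliftP ord0 i) i0 => [k -> _|->] //; by exists k.
- by move=> [i _ <-]; exists ord0, (lift ord0 i).
- move=> [a [i [a1 i1 ->]]].
  have {a1}-> : a = lift ord0 ord0 by apply: val_inj.
  case: (unliftP ord0 i) i1 => [k ->|->] //.
  case: (unliftP ord0 k) => [l -> _|->] //; by exists l.
- by move=> [i _ <-]; exists (lift ord0 ord0), (lift ord0 (lift ord0 i)).
Qed.

Lemma basis_trace_in_genG (K : fieldType) (n : nat) (j : basisIdx n) :
  genG K n.+2 (basis_trace K j).
Proof.
case: j => [[i|i]|i]; first by do 2 left; exists i.
  by left; right; exists ord0, (lift ord0 i).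
by left; right; exists (lift ord0 ord0), (lift ord0 (lift ord0 i)).
Qed.

Lemma maximal_basis_traces (K : numClosedFieldType) (n : nat)
    (T : set (charRing K n.+2)) :
  range (@basis_trace K n) `<=` T -> T `<=` genG K n.+2 -> alg_independent T ->
  T = range (@basis_trace K n).
Proof.
move=> BT TG T_indep; apply/seteqP; split=> // x Tx.
pose B (m : 'I_#|basisIdx n|) := basis_trace K (enum_val m).
have B_indep : independent_family B := @basis_trace_independent K n.
have BT' m : T (B m) by apply: BT; eexists.
have val_inj' : injective (\val : charRing K n.+2 -> coordSL K n.+2) := val_inj.
have evX m : basis_eval K n 'X_m = \val (B m).
  by rewrite -[m in LHS]enum_valK basis_eval_var.
pose v : {rmorphism charRing K n.+2 -> coordSL K n.+2} := \val.
have [m _ <-] := independent_family_maximal (A := charRing K n.+2) (v := v)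
  val_inj' (@basis_evalC K n) evX B_indep T_indep BT' Tx (genG_algebraic (TG _ Tx)).
by eexists.
Qed.

Theorem theorem2p2 (R : realType) (r : nat) (hr : (2 <= r)%N) :
  let B1 := genG1 R[i] r in
  let B2 := traces_with_X1 R[i] r in
  let B3 := traces_with_X2 R[i] r in
  let B := B1 `|` B2 `|` B3 in
  [/\ alg_independent B,
      [/\ B1 #= `I_r, B2 #= `I_(r - 1)%N & B3 #= `I_(r - 2)%N],
      (r + (r - 1) + (r - 2) = 3 * r - 3)%N /\ B #= `I_(3 * r - 3)%N &
      maximal_alg_independent (genG R[i] r) B].
Proof.
case: r hr => [//|[//|n]] _ B1 B2 B3 B.
pose tau := @basis_trace R[i] n.
have [B1E B2E B3E] := traces_rangeE R[i] n.
have BE : B = range tau.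
  rewrite /B /B1 /B2 /B3 B1E B2E B3E; apply/seteqP; split=> x.
    by case=> [[[i _ <-]|[i _ <-]]|[i _ <-]]; eexists.
  case=> [[[i|i]|i] _ <-]; first by do 2 left; exists i.
    by left; right; exists i.
  by right; exists i.
pose B' (m : 'I_#|basisIdx n|) := tau (enum_val m).
have indep : independent_family B' := @basis_trace_independent R[i] n.
have tau_inj : injective tau.
  move=> i j tij; apply: enum_rank_inj; apply: (independent_family_inj indep).
  by rewrite /B' !enum_rankK.
have B_indep : alg_independent B.
  rewrite BE (_ : range tau = range B').
    exact: alg_independent_range.
  apply/seteqP; split=> x [j _ <-]; last by eexists.
  by exists (enum_rank j); rewrite // /B' enum_rankK.
have cardJ : #|basisIdx n| = (n.+2 + n.+1 + n)%N by rewrite !card_sum !card_ord.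
have sizeE : (n.+2 + n.+1 + n = 3 * n.+2 - 3)%N by lia.
split=> //.
- rewrite /B1 /B2 /B3 B1E B2E B3E !subSS !subn0; split.
  + rewrite -[X in `I_X]card_ord; apply: card_range_finType.
    by move=> i j /tau_inj [].
  + rewrite -[X in `I_X]card_ord; apply: card_range_finType.
    by move=> i j /tau_inj [].
  + rewrite -[X in `I_X]card_ord; apply: card_range_finType.
    by move=> i j /tau_inj [].
- split; first by rewrite !subSS !subn0.
  by rewrite BE -sizeE -cardJ; apply: card_range_finType.
- split=> //; rewrite BE; first by move=> x [j _ <-]; apply: basis_trace_in_genG.
  move=> T; exact: maximal_basis_traces.
Qed.
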